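(* Assume that for every non-constant natural function $g\in\mathcal{F}_{Natural}$ one has $g(\mathbb{I})\not\subset\mathbb{P}$. Let $f\in\mathcal{F}_{Natural}$ be non-constant. Then the set $\{x\in f(\mathbb{I})\mid x \text{ is not a prime number}\}$ is infinite.
   Context: Let $\mathbb{I}=\{1,2,3,\ldots\}$ be the set of non-zero positive integers, $\mathbb{P}$ the set of prime numbers, and $\mathcal{F}$ the set of all functions from $\mathbb{I}$ to $\mathbb{I}$. For $f,g\in\mathcal{F}$, the functions $f+g$, $f\times g$, $f\wedge g$ are defined pointwise, where $\wedge$ is exponentiation: $(f\wedge g)(n)=f(n)^{g(n)}$. Let $\mathcal{F}_s\subset\mathcal{F}$ be the set consisting of the identity map $n\mapsto n$ and all constant maps $n\mapsto a$ with $a\in\mathbb{I}$. For a subset $P\subset\mathcal{F}$ and an operation $*\in\{+,\times,\wedge\}$ put $A_*(P)=P\cup\{f\in\mathcal{F}\mid \exists g\in P,\ \exists h\in P,\ f=g*h\}$. Let $\Sigma$ be the set of all finite words in the letters $A_+,A_\times,A_\wedge$ (each word acting on subsets of $\mathcal{F}$ by composition). The set of natural functions is $\mathcal{F}_{Natural}=\bigcup_{\sigma\in\Sigma}\sigma(\mathcal{F}_s)$. *)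

(* Defs.v *)
From mathcomp Require Import all_boot.
From mathcomp Require Import boolp classical_sets cardinality.

Set Implicit Arguments.
Unset Strict Implicit.
Unset Printing Implicit Defensive.

Local Open Scope classical_set_scope.

Definition posint := {n : nat | 0 < n}.

Lemma addI_gt0 (m n : posint) : 0 < val m + val n.
Proof. by rewrite addn_gt0 (valP m). Qed.

Lemma mulI_gt0 (m n : posint) : 0 < val m * val n.
Proof. by rewrite muln_gt0 (valP m) (valP n). Qed.

Lemma expI_gt0 (m n : posint) : 0 < val m ^ val n.
Proof. by rewrite expn_gt0 (valP m). Qed.

Definition addI (m n : posint) : posint := Sub (val m + val n) (addI_gt0 m n).
Definition mulI (m n : posint) : posint := Sub (val m * val n) (mulI_gt0 m n).
Definition expI (m n : posint) : posint := Sub (val m ^ val n) (expI_gt0 m n).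

Definition primes_set : set posint := [set p | prime (val p)].

Definition pfun := posint -> posint.

Definition constant_pfun (f : pfun) : Prop := exists a : posint, f = (fun=> a).

Variant operation := Add | Mul | Exp.

Definition op_posint (o : operation) : posint -> posint -> posint :=
  match o with Add => addI | Mul => mulI | Exp => expI end.

Definition op_pfun (o : operation) (g h : pfun) : pfun :=
  fun n => op_posint o (g n) (h n).

Definition simple_pfuns : set pfun :=
  [set f | f = id \/ constant_pfun f].

(* adjoin Add, adjoin Mul and adjoin Exp are the maps A_+, A_x and A_^. *)
Definition adjoin (o : operation) (P : set pfun) : set pfun :=
  P `|` [set f | exists2 g, P g & exists2 h, P h & f = op_pfun o g h].

(* A word [:: o1; ...; ok] in the letters A_+, A_x, A_^ acts as the composite
   A_o1 \o ... \o A_ok; the empty word acts as the identity. *)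
Definition word_act (w : seq operation) (P : set pfun) : set pfun :=
  foldr adjoin P w.

Definition natural_pfuns : set pfun :=
  \bigcup_(w in [set: seq operation]) word_act w simple_pfuns.

(* Main.v *)
Require Import Defs.
From mathcomp Require Import all_boot.
From mathcomp Require Import boolp classical_sets cardinality.

(** Each operation preserves the dichotomy "constant or strictly increasing",
    so a non-constant natural function is strictly increasing, in particular
    injective. If it had finitely many non-prime values, then its values would
    all be prime from some point on, and a translate [n |-> f (n + b)], which is
    again natural and non-constant, would take only prime values. *)

Local Open Scope classical_set_scope.

Lemma subset_adjoin (o : operation) (P : set pfun) : P `<=` adjoin o P.
Proof. by move=> f Pf; left. Qed.

Lemma adjoinS (o : operation) (P Q : set pfun) :
  P `<=` Q -> adjoin o P `<=` adjoin o Q.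
Proof.
move=> PQ f [/PQ Qf|[g /PQ Qg [h /PQ Qh ->]]]; first by left.
by right; exists g => //; exists h.
Qed.

Lemma subset_word_act (w : seq operation) (P : set pfun) : P `<=` word_act w P.
Proof.
elim: w => [//|o w IHw]; exact: subset_trans IHw (@subset_adjoin o _).
Qed.

Lemma word_actS (w : seq operation) (P Q : set pfun) :
  P `<=` Q -> word_act w P `<=` word_act w Q.
Proof. by move=> PQ; elim: w => [//|o w IHw]; exact: adjoinS. Qed.

Lemma natural_simple (f : pfun) : simple_pfuns f -> natural_pfuns f.
Proof. by move=> sf; exists [::]. Qed.

(** If [u] produces [g] and [v] produces [h], the word [u ++ v] produces both: letters only enlarge
    a set, which gives [h], and [u] acts monotonically, which gives [g]. *)
Lemma natural_op (o : operation) (g h : pfun) :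
  natural_pfuns g -> natural_pfuns h -> natural_pfuns (op_pfun o g h).
Proof.
move=> [u _ ug] [v _ vh]; exists (o :: u ++ v) => //; right.
rewrite -/(word_act (u ++ v) simple_pfuns) /word_act foldr_cat.
exists g; first exact: word_actS (@subset_word_act v _) _ ug.
by exists h => //; exact: subset_word_act vh.
Qed.

Lemma natural_ind (P : pfun -> Prop) :
  P id -> (forall a : posint, P (fun=> a)) ->
  (forall o g h, P g -> P h -> P (op_pfun o g h)) ->
  forall f, natural_pfuns f -> P f.
Proof.
move=> Pid Pcst Pop f [w _]; elim: w f => [|o w IHw] f /=.
  by case=> [->|[a ->]].
case=> [|[g wg [h wh ->]]]; first exact: IHw.
by apply: Pop; apply: IHw.
Qed.

(** Translation commutes with the pointwise operations and fixes constants; the identity becomes the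
    sum of [id] and the constant [b]. *)
Lemma natural_translate (b : posint) (f : pfun) :
  natural_pfuns f -> natural_pfuns (fun n => f (addI n b)).
Proof.
move: f; apply: natural_ind => [|a|o g h].
- apply: (@natural_op Add id (fun=> b)); apply: natural_simple; first by left.
  by right; exists b.
- by apply: natural_simple; right; exists a.
- exact: natural_op.
Qed.

Definition increasing_pfun (f : pfun) : Prop :=
  forall m n : posint, val m < val n -> val (f m) < val (f n).

(** The constant alternative arises only for [Exp] with base [a] equal to 1. *)
Lemma op_increasing_r (o : operation) (a : posint) (h : pfun) :
  increasing_pfun h ->
  constant_pfun (op_pfun o (fun=> a) h) \/
  increasing_pfun (op_pfun o (fun=> a) h).
Proof.
move=> ih; case: o.
- by right=> m n /ih hmn; rewrite /= ltn_add2l.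
- by right=> m n /ih hmn; rewrite /= ltn_pmul2l // (valP a).
- have [a_le1|a_gt1] := leqP (val a) 1.
    left; exists a; apply: funext => n; apply: val_inj => /=.
    have -> : val a = 1 by apply/eqP; rewrite eqn_leq a_le1 (valP a).
    by rewrite exp1n.
  by right=> m n /ih hmn; rewrite /= ltn_exp2l.
Qed.

(** Weak monotonicity of [h] covers constant and increasing functions at once. Strictness comes from
    [g] and survives products and powers because the values of [h] are positive. *)
Lemma op_increasing_l (o : operation) (g h : pfun) :
  increasing_pfun g -> (forall m n, val m < val n -> val (h m) <= val (h n)) ->
  increasing_pfun (op_pfun o g h).
Proof.
move=> ig mh m n mn; have gmn := ig _ _ mn; have hmn := mh _ _ mn.
case: o => /=.
- by rewrite -addSn leq_add.
- by apply: leq_trans (leq_mul (leqnn _) hmn); rewrite ltn_pmul2r // (valP (h m)).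
- apply: (@leq_trans (val (g n) ^ val (h m))).
    by rewrite ltn_exp2r // (valP (h m)).
  by rewrite leq_pexp2l // (valP (g n)).
Qed.

Lemma natural_constant_or_increasing (f : pfun) :
  natural_pfuns f -> constant_pfun f \/ increasing_pfun f.
Proof.
move: f; apply: natural_ind => [|a|o g h]; first by right.
  by left; exists a.
move=> [[a ->]|ig] [[b ->]|ih].
- by left; exists (op_posint o a b).
- exact: op_increasing_r.
- by right; apply: op_increasing_l.
- by right; apply: op_increasing_l => // m n /ih/ltnW.
Qed.

Lemma increasing_pfun_inj (f : pfun) : increasing_pfun f -> injective f.
Proof.
move=> incf m n fmn; apply: val_inj.
by case: (ltngtP (val m) (val n)) => // /incf; rewrite fmn ltnn.
Qed.

Lemma finite_posint_bounded (A : set posint) :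
  finite_set A -> exists b : posint, forall n, A n -> val n <= val b.
Proof.
move=> /finite_seqP[s ->].
(* The successor keeps the bound positive even when [s] is empty. *)
exists (Sub (\max_(n <- s) val n).+1 (ltn0Sn _)) => n /= sn.
by apply: leqW; apply: (@leq_bigmax_seq _ s xpredT (fun n : posint => val n)).
Qed.

Theorem proposition3p1
  (Hprime : forall g : pfun, natural_pfuns g -> ~ constant_pfun g ->
     ~ (range g `<=` primes_set))
  (f : pfun) (Hf : natural_pfuns f) (Hnc : ~ constant_pfun f) :
  infinite_set [set x | range f x /\ ~ primes_set x].
Proof.
have [//|incf] := @natural_constant_or_increasing f Hf.
have injf := @increasing_pfun_inj f incf.
move=> finS.
(* By injectivity only finitely many arguments have a non-prime value; [b] bounds them all. *)
have /finite_posint_bounded[b ltb] :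
    finite_set (f @^-1` [set x | range f x /\ ~ primes_set x]).
  by apply: finite_preimage finS => m n _ _; exact: injf.
apply: (Hprime (fun n => f (addI n b))); first exact: natural_translate.
  (* A constant translate would take equal values at 1 and 2, against injectivity of [f]. *)
  move=> [a fa]; pose one : posint := Sub 1 isT; pose two : posint := Sub 2 isT.
  have /injf/(congr1 val)/= : f (addI one b) = f (addI two b).
    by rewrite -[LHS]/((fun n => f (addI n b)) one) fa -[RHS]/((fun n => f (addI n b)) two) fa.
  by move=> /eqP; rewrite eqn_add2r.
move=> _ [n _ <-]; apply: contrapT => fn.
(* A non-prime value at [n + b] would force [n + b <= b], impossible as [n] is positive. *)
have /= := ltb (addI n b) (conj (imageT f _) fn).
by rewrite leqNgt -[X in X < _]add0n ltn_add2r (valP n).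
Qed.
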